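(* Let $F$ be a polybox in a $d$-box $X$ and let $\mathcal{F}$ be a partition of $F$ into proper boxes of $X$. Then $\mathcal{F}$ is minimal (i.e. has the smallest cardinality among all partitions of $F$ into proper boxes of $X$) if and only if $\mathcal{F}$ is a suit.
   Context: A $d$-box is $X=X_1\times\cdots\times X_d$ with finite nonempty sets $X_i$. A box in $X$ is a nonempty $A=A_1\times\cdots\times A_d$ with $A_i\subseteq X_i$; it is proper if $A_i\neq X_i$ for all $i$. Boxes $A,B$ are dichotomous if $A_i=X_i\setminus B_i$ for some $i\in[d]$. A suit is a family of pairwise dichotomous boxes; it is proper if all its boxes are proper. A nonempty $F\subseteq X$ is a polybox if $F=\bigcup\mathcal{F}$ for some suit $\mathcal{F}$. *)

(* Defs.v *)
From mathcomp Require Import all_boot.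

Set Implicit Arguments.
Unset Strict Implicit.
Unset Printing Implicit Defensive.

Section Polybox.

(* The i-th factor of the d-box is the whole finite type X i; its nonemptiness
   is a hypothesis of the theorem. *)
Variables (d : nat) (X : 'I_d -> finType).

Definition dbox : finType := {dffun forall i : 'I_d, X i}.

Implicit Types (A B F : {set dbox}) (P : {set {set dbox}}).

(* Since A is nonempty, the factors A_ are uniquely determined by A, so the
   choice of A_ in the existential quantifiers below is immaterial. *)
Definition box_with (A_ : forall i : 'I_d, {set X i}) A : Prop :=
  A = setXn A_ /\ A <> set0.

Definition is_box A : Prop :=
  exists A_ : forall i : 'I_d, {set X i}, box_with A_ A.

Definition is_proper_box A : Prop :=
  exists A_ : forall i : 'I_d, {set X i}, box_with A_ A /\ forall i, A_ i <> [set: X i].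

Definition dichotomous A B : Prop :=
  exists A_ B_ : forall i : 'I_d, {set X i},
    [/\ box_with A_ A, box_with B_ B &
      exists i, A_ i = [set: X i] :\: B_ i].

Definition suit P : Prop :=
  (forall A, A \in P -> is_box A) /\
  (forall A B, A \in P -> B \in P -> A <> B -> dichotomous A B).

Definition polybox F : Prop :=
  F <> set0 /\ exists P, suit P /\ F = cover P.

Definition proper_box_partition P F : Prop :=
  partition P F /\ forall A, A \in P -> is_proper_box A.

Definition minimal_partition P F : Prop :=
  proper_box_partition P F /\
  forall Q, proper_box_partition Q F -> #|P| <= #|Q|.

End Polybox.

(* Main.v *)
Require Import Defs.
From mathcomp Require Import all_boot.

(** Probe a set [F] with the products [R = R_1 x ... x R_d] of odd-size sets
    [R_i].  If [A] is a proper box, then [A] meets exactly a fraction [2^-d] of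
    the probes in an odd number of points.  If a partition [P] of [F] consists
    of proper boxes, every probe meeting [F] oddly meets some box of [P] oddly;
    so the number [n] of such probes satisfies [n <= |P| c], where [c] is the
    number of probes meeting a given proper box oddly.  Equality holds iff no
    probe meets two boxes of [P] oddly, and this says exactly that the boxes of
    [P] are pairwise dichotomous.  A polybox admits a proper suit (cut the
    improper factors of any suit into two pieces), so the bound is attained. *)

Set Implicit Arguments.
Unset Strict Implicit.
Unset Printing Implicit Defensive.

(** * Parity of cardinalities, and odd subsets of one finite set *)

Lemma odd_prodn (I : finType) (f : I -> nat) :
  odd (\prod_i f i) = [forall i, odd (f i)].
Proof. by rewrite (big_morph odd oddM (erefl _)) big_andE. Qed.

Lemma odd_sumn (I : finType) (D : {set I}) (f : I -> nat) :
  odd (\sum_(i in D) f i) = odd #|[set i in D | odd (f i)]|.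
Proof.
rewrite -sum1dep_card big_mkcondr /=.
elim/big_rec2: _ => // i m n _ IH.
by rewrite !oddD IH; case: (odd (f i)).
Qed.

Section OddSubsets.

Variable T : finType.
Implicit Types (A B S : {set T}) (a b x : T).

(** Symmetric difference with the singleton of [x]. *)
Definition toggle x S : {set T} := [set y | (y == x) (+) (y \in S)].

Lemma toggleK x : involutive (toggle x).
Proof. by move=> S; apply/setP => y; rewrite !inE addKb. Qed.

Lemma odd_card_toggle x S : odd #|toggle x S| = ~~ odd #|S|.
Proof.
wlog xS : S / x \in S => [IH|].
  have [/IH //|xS] := boolP (x \in S).
  rewrite -{2}(toggleK x S) (IH (toggle x S)) ?negbK //.
  by rewrite inE eqxx (negbTE xS).
rewrite (cardsD1 x S) xS /= negbK; congr (odd #|pred_of_set _|).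
by apply/setP => y; rewrite !inE; case: eqP => // ->; rewrite xS.
Qed.

Lemma odd_cardI_toggle A x S :
  odd #|A :&: toggle x S| = (x \in A) (+) odd #|A :&: S|.
Proof.
case: (boolP (x \in A)) => xA /=.
  rewrite -(odd_card_toggle x); congr (odd #|pred_of_set _|).
  by apply/setP => y; rewrite !inE; case: eqP => [->|]; rewrite ?xA.
congr (odd #|pred_of_set _|); apply/setP => y; rewrite !inE.
by case: eqP => [->|]; rewrite ?(negbTE xA).
Qed.

Definition odd_sets : {set {set T}} := [set S : {set T} | odd #|S|].

(* Toggling a point inside [A] together with one outside preserves the parity
   of [#|S|] and flips that of [#|A :&: S|]. *)
Lemma card_odd_setsI A : A != set0 -> A != setT ->
  #|[set S in odd_sets | odd #|A :&: S|]| = #|odd_sets|./2.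
Proof.
move=> /set0Pn[a aA]; rewrite -subTset => /subsetPn[b _ bA].
pose flip S := toggle a (toggle b S).
have flip_inj : injective flip.
  exact: inj_comp (inv_inj (toggleK a)) (inv_inj (toggleK b)).
set E := [set S in _ | _].
have -> : #|odd_sets| = (#|E|).*2.
  rewrite -(cardsID E) -addnn (setIidPr _); last by apply/subsetP => S /setIdP[].
  congr (_ + _); rewrite -(card_preimset E flip_inj); apply: eq_card => S.
  rewrite !inE !odd_card_toggle !odd_cardI_toggle aA (negbTE bA) /=.
  by rewrite negbK; case: (odd #|S|); rewrite ?andbT.
by rewrite doubleK.
Qed.

(** If [A] and [B] meet, a common point alone serves. If they are disjoint, then, not being
    complementary, they both miss some point [c], which is joined to one point of each. *)
Lemma odd_common_probe A B : A != set0 -> B != set0 -> A != ~: B ->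
  exists S, [&& odd #|S|, odd #|A :&: S| & odd #|B :&: S|].
Proof.
move=> /set0Pn[a aA] /set0Pn[b bB] neAB.
have card1I (D : {set T}) x : x \in D -> #|D :&: [set x]| = 1.
  by move=> xD; rewrite (setIidPr _) ?cards1 ?sub1set.
have [AB0|[x]] := set_0Vmem (A :&: B); last first.
  by case/setIP=> xA xB; exists [set x]; rewrite cards1 !card1I.
have notAB x : x \in A -> x \in B -> False.
  by move=> xA xB; have := in_set0 x; rewrite -AB0 inE xA xB.
have [c /norP[cA cB]] : exists c, ~~ ((c \in A) || (c \in B)).
  apply/existsP; apply: contraNT neAB; rewrite negb_exists => /forallP AB.
  apply/eqP/setP => x; rewrite inE; have := AB x; rewrite negbK.
  by have := @notAB x; case: (x \in A); case: (x \in B) => // /(_ isT isT).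
have aB : a \in B = false by apply/negP => /(notAB _ aA).
have bA : b \in A = false by apply/negP => /notAB/(_ bB).
(* This is [{a, b, c}]: the points are distinct, as they lie in [A] only, in [B] only and in
   neither. *)
exists (toggle a (toggle b [set c])).
rewrite !odd_card_toggle cards1 !odd_cardI_toggle aA bB aB bA /=.
have D0 (D : {set T}) : c \notin D -> D :&: [set c] = set0.
  move=> cD; apply/setP => x; rewrite !inE.
  by case: eqP => [->|]; rewrite ?andbF // (negbTE cD).
by rewrite !D0 // cards0.
Qed.

End OddSubsets.

(** * Canonical factors of boxes *)

Section Polybox.

Variables (d : nat) (X : 'I_d -> finType).
Implicit Types (A B F : {set dbox X}) (P Q : {set {set dbox X}}).

(** Projection of [A] to coordinate [i]; for a box it recovers the factors that the definitions
    quantify existentially. *)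
Definition factor A (i : 'I_d) : {set X i} := [set z i | z : dbox X in A].

Lemma mem_factor A (z : dbox X) i : z \in A -> z i \in factor A i.
Proof. by move=> zA; apply: imset_f. Qed.

Lemma box_with_factor (A_ : forall i, {set X i}) A i :
  box_with A_ A -> A_ i = factor A i.
Proof.
case=> -> /eqP/set0Pn[w /setXnP wA]; apply/setP => x; apply/idP/imsetP.
  (* Replacing coordinate [i] of a point [w] of [A] by [x] stays in [A]. *)
  move=> xA; exists (finfun (dfwith (w : forall i, X i) x)); last first.
    by rewrite ffunE dfwith_in.
  by apply/setXnP => j; rewrite ffunE; case: dfwithP.
by case=> z /setXnP zA ->.
Qed.

Lemma is_box_factor A : is_box A -> box_with (factor A) A.
Proof.
case=> A_ bA; have [eA neA] := bA; split=> //; rewrite {1}eA.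
by apply: eq_setXn => i; apply: box_with_factor bA.
Qed.

Lemma factor_neq0 A i : A <> set0 -> factor A i != set0.
Proof.
by move=> /eqP/set0Pn[z /(mem_factor i) zA]; apply/set0Pn; exists (z i).
Qed.

Lemma proper_boxP A :
  is_proper_box A <-> is_box A /\ forall i, factor A i != setT.
Proof.
split=> [[A_ [bA pA]]|[bA pA]].
  by split=> [|i]; [exists A_ | rewrite -(box_with_factor i bA); apply/eqP/pA].
by exists (factor A); split=> [|i]; [apply: is_box_factor | apply/eqP].
Qed.

Lemma dichotomousP A B : is_box A -> is_box B ->
  dichotomous A B <-> exists i, factor A i = ~: factor B i.
Proof.
move=> bA bB; split=> [[A_ [B_ [wA wB [i]]]]|[i eAB]].
  by rewrite (box_with_factor i wA) (box_with_factor i wB) setTD; exists i.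
exists (factor A), (factor B); split; try exact: is_box_factor.
by exists i; rewrite setTD.
Qed.

Lemma dichotomous_disjoint A B : is_box A -> is_box B ->
  dichotomous A B -> [disjoint A & B].
Proof.
move=> bA bB /(dichotomousP bA bB)[i eAB]; rewrite disjoint_subset.
apply/subsetP => z /(mem_factor i); rewrite eAB !inE.
by apply: contra => /mem_factor.
Qed.

Lemma suit_trivIset P : suit P -> trivIset P.
Proof.
case=> bP dP; apply/trivIsetP => A B AP BP /eqP neAB.
exact: dichotomous_disjoint (bP A AP) (bP B BP) (dP A B AP BP neAB).
Qed.

(** * Probes and the count of odd meetings *)

Definition probe : finType := {dffun forall i : 'I_d, {set X i}}.

Definition probes : {set probe} := setXn (fun i => odd_sets (X i)).

Definition meets_odd A (R : probe) : bool := odd #|A :&: setXn R|.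

Lemma meets_odd_box A (R : probe) : is_box A ->
  meets_odd A R = [forall i, odd #|factor A i :&: R i|].
Proof.
case/is_box_factor=> eA _; rewrite /meets_odd {1}eA.
have -> : setXn (factor A) :&: setXn R = setXn (fun i => factor A i :&: R i).
  apply/setP => z; rewrite inE; apply/andP/setXnP.
    by case=> /setXnP zA /setXnP zR i; rewrite inE zA zR.
  by move=> zAR; split; apply/setXnP => i; case/setIP: (zAR i).
by rewrite cardsXn odd_prodn.
Qed.

(** The number of probes that a proper box meets oddly. *)
Definition odd_weight : nat := \prod_i #|odd_sets (X i)|./2.

(** The condition of odd meeting splits over the coordinates, and in each one exactly half of the
    odd sets satisfy it. *)
Lemma card_probes_proper A : is_proper_box A ->
  #|[set R in probes | meets_odd A R]| = odd_weight.
Proof.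
case/proper_boxP=> bA pA; have [_ neA] := is_box_factor bA.
transitivity
  #|setXn (fun i => [set S in odd_sets (X i) | odd #|factor A i :&: S|])|.
  apply: eq_card => R; rewrite inE meets_odd_box //.
  apply/andP/setXnP => [[/setXnP Ro /forallP RA] i|RA].
    by rewrite inE Ro RA.
  by split; [apply/setXnP => i | apply/forallP => i]; case/setIdP: (RA i).
by rewrite cardsXn; apply: eq_bigr => i _; rewrite card_odd_setsI ?factor_neq0.
Qed.

(** Complementary factors would split the odd set [R i] into two odd parts. *)
Lemma dichotomous_meets_odd A B R : is_box A -> is_box B -> R \in probes ->
  dichotomous A B -> meets_odd A R -> meets_odd B R -> False.
Proof.
move=> bA bB /setXnP Ro /(dichotomousP bA bB)[i eAB].
rewrite !meets_odd_box // => /forallP/(_ i); rewrite eAB => oA /forallP/(_ i) oB.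
have := Ro i; rewrite inE -(cardsID (factor B i)) oddD setIC oB.
by rewrite setDE setIC oA.
Qed.

Lemma common_probe A B : is_box A -> is_box B -> ~ dichotomous A B ->
  exists R, [/\ R \in probes, meets_odd A R & meets_odd B R].
Proof.
move=> bA bB ndAB.
have [_ neA] := is_box_factor bA; have [_ neB] := is_box_factor bB.
have /fin_all_exists[R RP] i : exists S : {set X i},
    [&& odd #|S|, odd #|factor A i :&: S| & odd #|factor B i :&: S|].
  apply: odd_common_probe; rewrite ?factor_neq0 //.
  by apply/eqP => eAB; apply/ndAB/(dichotomousP bA bB); exists i.
exists (finfun R); rewrite !meets_odd_box //; split.
- by apply/setXnP => i; rewrite ffunE inE; case/and3P: (RP i).
- by apply/forallP => i; rewrite ffunE; case/and3P: (RP i).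
- by apply/forallP => i; rewrite ffunE; case/and3P: (RP i).
Qed.

Lemma odd_weight_gt0 A : is_proper_box A -> 0 < odd_weight.
Proof.
move=> pA; have /proper_boxP[bA _] := pA.
have [_ /eqP/set0Pn[z zA]] := is_box_factor bA.
(* A box is not dichotomous to itself, so some probe meets it oddly. *)
have [|R [Ro RA _]] := common_probe bA bA.
  by case/(dichotomousP bA bA) => i /setP/(_ (z i)); rewrite inE mem_factor.
by rewrite -(card_probes_proper pA); apply/card_gt0P; exists R; rewrite inE Ro.
Qed.

Definition odd_boxes P (R : probe) := [set A in P | meets_odd A R].

(** A probe meets [F] oddly iff the number [k] of blocks it meets oddly is odd. Now sum
    [odd k <= k], with equality iff [k <= 1], over all probes; double counting evaluates the sum of
    the [k]. *)
Lemma odd_probes_leqif P F : proper_box_partition P F ->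
  #|[set R in probes | meets_odd F R]| <= #|P| * odd_weight
    ?= iff [forall (R | R \in probes), #|odd_boxes P R| <= 1].
Proof.
case=> partP propP.
have -> : #|[set R in probes | meets_odd F R]|
          = \sum_(R in probes) odd #|odd_boxes P R|.
  rewrite -sum1dep_card big_mkcondr /=; apply: eq_bigr => R _.
  rewrite /meets_odd -sum1_card; under eq_bigl do rewrite inE.
  rewrite (set_partition_big_cond _ partP) odd_sumn.
  set D := [set A in _ | _].
  suff -> : D = odd_boxes P R by case: odd.
  apply/setP => A; rewrite !inE /meets_odd -[#|A :&: _|]sum1_card.
  by congr (_ && odd _); apply: eq_bigl => z; rewrite in_setI.
have -> : #|P| * odd_weight = \sum_(R in probes) #|odd_boxes P R|.
  under [RHS]eq_bigr do rewrite -sum1dep_card big_mkcondr /=.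
  rewrite exchange_big -sum_nat_const /=; apply: eq_bigr => A AP.
  by rewrite -(card_probes_proper (propP A AP)) -sum1dep_card big_mkcondr.
apply: leqif_sum => R _; case: #|_| => [|[|n]]; apply/leqifP => //=.
by case: odd.
Qed.

(** The equality case: some probe meets two blocks oddly exactly when two distinct blocks fail to be
    dichotomous. *)
Lemma suit_iff_odd_probes P F : proper_box_partition P F ->
  suit P <-> #|[set R in probes | meets_odd F R]| = #|P| * odd_weight.
Proof.
move=> pP; have [_ propP] := pP.
have bP A : A \in P -> is_box A by case/propP/proper_boxP.
apply: (iff_trans _ (iff_sym (rwP eqP))).
rewrite (odd_probes_leqif pP); split=> [[_ dP]|/forall_inP leP].
  apply/forall_inP => R Ro; apply/card_le1_eqP => B A.
  case/setIdP=> BP RB /setIdP[AP RA]; apply/eqP/negPn/negP => /eqP neAB.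
  exact: (dichotomous_meets_odd (bP A AP) (bP B BP) Ro (dP _ _ AP BP neAB) RA RB).
split=> // A B AP BP neAB.
apply/(dichotomousP (bP A AP) (bP B BP)).
have [/existsP[i /eqP]|ndAB] :=
  boolP [exists i, factor A i == ~: factor B i]; first by exists i.
have [|R [Ro RA RB]] := common_probe (bP A AP) (bP B BP).
  case/(dichotomousP (bP A AP) (bP B BP)) => i /eqP eAB.
  by case/existsP: ndAB; exists i.
case: neAB; have /card_le1_eqP := leP R Ro.
by apply; rewrite inE ?AP ?BP.
Qed.

(** * Refining a suit into a proper one *)

Section Refine.

Variables (C : forall i, {set X i}) (Q : {set {set dbox X}}).
Hypotheses (C_neq0 : forall i, C i != set0) (C_neqT : forall i, C i != setT).
Hypothesis suitQ : suit Q.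

(** Pieces are named by the points in them, which makes covering and nonemptiness immediate; several
    points may name one piece. *)
Definition refine_factor (z : dbox X) i : {set X i} :=
  if factor (pblock Q z) i == setT then (if z i \in C i then C i else ~: C i)
  else factor (pblock Q z) i.

Definition refine_block (z : dbox X) : {set dbox X} := setXn (refine_factor z).

Definition refine_suit : {set {set dbox X}} :=
  [set refine_block z | z in cover Q].

Lemma mem_refine_block z : z \in cover Q -> z \in refine_block z.
Proof.
move=> zQ; apply/setXnP => i; rewrite /refine_factor.
case: ifP => _; last by rewrite mem_factor ?mem_pblock.
by case: ifP => // zC; rewrite inE zC.
Qed.

Lemma refine_block_with z : z \in cover Q ->
  box_with (refine_factor z) (refine_block z).
Proof.
by move=> zQ; split=> //; apply/eqP/set0Pn; exists z; apply: mem_refine_block.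
Qed.

Lemma refine_block_proper z : z \in cover Q -> is_proper_box (refine_block z).
Proof.
move=> zQ; exists (refine_factor z); split=> [|i].
  exact: refine_block_with.
apply/eqP; rewrite /refine_factor; case: ifP => [_|->] //.
case: ifP => _ //; apply: contra (C_neq0 i) => /eqP CT.
by rewrite -[C i]setCK CT setCT.
Qed.

Lemma refine_block_sub z : z \in cover Q -> refine_block z \subset cover Q.
Proof.
move=> zQ; have AQ := pblock_mem zQ.
apply: (subset_trans _ (bigcup_sup _ AQ)).
have [eA _] := is_box_factor (suitQ.1 _ AQ); rewrite eA.
apply: setXnS => i; rewrite /refine_factor.
by case: ifP => // /eqP ->; apply: subsetT.
Qed.

Lemma refine_suitP : suit refine_suit.
Proof.
split=> [_ /imsetP[z zQ ->]|].
  by case/proper_boxP: (refine_block_proper zQ).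
move=> _ _ /imsetP[z zQ ->] /imsetP[w wQ ->] ne_zw.
exists (refine_factor z), (refine_factor w).
split; try exact: refine_block_with.
have [bQ dQ] := suitQ; have [zA wB] := (pblock_mem zQ, pblock_mem wQ).
have [eAB|/eqP neAB] := eqVneq (pblock Q z) (pblock Q w).
  (* Two pieces of one block can differ only at a cut factor, where they are [C i] and its
     complement. *)
  have /existsP[i ne_i] : [exists i, refine_factor z i != refine_factor w i].
    apply: contra_notT ne_zw; rewrite negb_exists => /forallP eq_zw.
    by apply: eq_setXn => i; apply/eqP; rewrite -[_ == _]negbK eq_zw.
  exists i; move: ne_i; rewrite setTD /refine_factor eAB.
  by case: ifP => _; [do 2!case: ifP => _|]; rewrite ?eqxx ?setCK.
have /(dichotomousP (bQ _ zA) (bQ _ wB))[i eAB] := dQ _ _ zA wB neAB.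
(* Complementary nonempty factors are both different from [setT], so neither is cut. *)
exists i; rewrite setTD /refine_factor.
have zi : z i \in factor (pblock Q z) i by rewrite mem_factor ?mem_pblock.
have wi : w i \in factor (pblock Q w) i by rewrite mem_factor ?mem_pblock.
case: ifP => [/eqP AT|_].
  by have := in_setT (w i); rewrite -AT eAB inE wi.
case: ifP => [/eqP BT|_] //.
by move: zi; rewrite eAB BT setCT inE.
Qed.

Lemma refine_suit_partition : proper_box_partition refine_suit (cover Q).
Proof.
split=> [|_ /imsetP[z zQ ->]]; last exact: refine_block_proper.
apply/and3P; split.
- apply/eqP/setP => y; apply/bigcupP/idP => [[_ /imsetP[z zQ ->]]|yQ].
    by apply/subsetP/refine_block_sub.
  by exists (refine_block y); [apply: imset_f | apply: mem_refine_block].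
- exact: suit_trivIset refine_suitP.
- apply/negP => /imsetP[z zQ e0].
  by have := mem_refine_block zQ; rewrite -e0 inE.
Qed.

End Refine.

End Polybox.

(** * Minimality as equality in the counting bound *)

Theorem theorem2p1 (d : nat) (X : 'I_d -> finType)
    (X_nonempty : forall i : 'I_d, 0 < #|X i|)
    (F : {set dbox X}) (hF : polybox F)
    (P : {set {set dbox X}}) (hP : proper_box_partition P F) :
  minimal_partition P F <-> suit P.
Proof.
have [neF [Q [suitQ eF]]] := hF; have [partP propP] := hP.
have [A AP] : exists A, A \in P.
  apply/set0Pn/eqP => P0; apply: neF.
  by rewrite -(cover_partition partP) P0 /cover big_set0.
have /proper_boxP[bA pA] := propP A AP; have [_ neA] := is_box_factor bA.
have w_gt0 := odd_weight_gt0 (propP A AP).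
have neA_ i := factor_neq0 i neA.
split=> [[_ minP]|/(suit_iff_odd_probes hP) eqP].
  (* The factors of the proper box [A] are nonempty and not full, so they serve as the cutting sets
     [C]. *)
  have sR := refine_suitP neA_ pA suitQ.
  have pR := refine_suit_partition neA_ pA suitQ; rewrite -eF in pR.
  (* The refined suit attains the bound and [P] has no more blocks, so [P] attains it too. *)
  apply/(suit_iff_odd_probes hP)/eqP.
  rewrite eqn_leq (odd_probes_leqif hP).
  by have /(suit_iff_odd_probes pR) -> := sR; rewrite leq_mul2r minP ?orbT.
split=> // R pR; rewrite -(leq_pmul2r w_gt0) -eqP.
exact: odd_probes_leqif pR.
Qed.
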